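(* Let $n\ge 2$, let $m\ge 2$ be even, and let $x_1,x_2,\dots,x_m$ be distinct elements of $\{1,\dots,n\}$, so that $(x_1\,x_2),(x_3\,x_4),\dots,(x_{m-1}\,x_m)$ are pairwise disjoint transpositions. Let $H=\langle (x_1\,x_2)(x_3\,x_4)\cdots(x_{m-1}\,x_m)\rangle$ and suppose $H$ is a subgroup of the alternating group $A_n$. Then $H$ is not a perfect code of $S_n$.
   Context: For a group $G$ and a subset $S\subseteq G\setminus\{1_G\}$ with $S=S^{-1}$, the Cayley graph $\mathrm{Cay}(G,S)$ has vertex set $G$, with $g$ and $h$ adjacent iff $hg^{-1}\in S$. A perfect code in a graph $\Gamma$ is a subset $C$ of the vertex set such that no two vertices of $C$ are adjacent and every vertex outside $C$ is adjacent to exactly one vertex of $C$. A subgroup $H$ of a group $G$ is a perfect code of $G$ (is ''perfect in $G$'') if there exists a Cayley graph $\mathrm{Cay}(G,S)$ of $G$ in which $H$ is a perfect code. *)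

(* Defs.v *)
From HB Require Import structures.
From mathcomp Require Import all_boot all_fingroup all_solvable.

Set Implicit Arguments.
Unset Strict Implicit.
Unset Printing Implicit Defensive.

Local Open Scope group_scope.

(* A graph is a vertex set V inside a finType together with an adjacency
   relation e, of which only the restriction to V matters. *)
Definition perfect_code (T : finType) (V : {set T}) (e : rel T) (C : {set T}) :=
  [/\ C \subset V,
      forall u v, u \in C -> v \in C -> ~~ e u v
    & forall v, v \in V -> v \notin C -> exists! u, u \in C /\ e v u].

Section Cayley.

Variable gT : finGroupType.

Definition connection_set (G S : {set gT}) : Prop :=
  S \subset G :\ 1 /\ S^-1 = S.

Definition cayley_adj (S : {set gT}) : rel gT := fun g h => h * g^-1 \in S.

Definition perfect_subgroup (G H : {group gT}) : Prop :=
  H \subset G /\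
  exists S : {set gT}, connection_set G S /\ perfect_code G (cayley_adj S) H.

End Cayley.

(* (x 1, x 2)(x 3, x 4) ... (x (m - 1), x m) for even m. *)
Definition prod_tperm (n m : nat) (x : nat -> 'I_n) : 'S_n :=
  \prod_(0 <= i < m./2) tperm (x i.*2.+1) (x i.*2.+2).

(* Main.v *)
(** Let [t] be the generator of [H].  As [t] is even, it is a product of an even
    number of disjoint transpositions; since (a b)(c d) is the square of a
    4-cycle, [t = g ^+ 2] for some permutation [g].  The coset [H g^-1] is then
    [{g^-1, g}], so an inverse-closed set [S] contains either both or none of
    its elements, and [g] has either two neighbours in [H] or none. *)
Require Import Defs.
From mathcomp Require Import all_boot all_fingroup all_solvable.

Set Implicit Arguments.
Unset Strict Implicit.
Unset Printing Implicit Defensive.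

Local Open Scope group_scope.

Lemma cycle_square_not_perfect (gT : finGroupType) (G H : {group gT}) (g : gT) :
  g \in G -> #[g] = 4 -> H :=: <[g ^+ 2]> -> ~ perfect_subgroup G H.
Proof.
move=> gG og defH [_ [S [[_ SV] [_ _ /(_ g gG)]]]].
have g2N1 : g ^+ 2 != 1 by rewrite -order_dvdn og.
have HE : H :=: [set 1; g ^+ 2].
  by rewrite defH; apply: cycle2g; rewrite orderXdiv og.
have g2V : g ^+ 2 * g^-1 = g by rewrite mulgK.
have gNH : g \notin H.
  rewrite HE !inE; apply/norP; split; first by rewrite -order_gt1 og.
  by apply: contraNneq g2N1 => gE; rewrite -gE -(inj_eq (mulgI g)) -expg2 -gE mulg1.
move=> /(_ gNH)[u [[uH ugS] u_uniq]].
have SVE s : (s^-1 \in S) = (s \in S) by rewrite -mem_invg SV.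
(* The neighbour [u] of [g] in [H] is [1] or [g ^+ 2], which puts [g^-1] or [g] in [S]; closure
   under inverses gives [g \in S] in both cases. Then [1] and [g ^+ 2] are both neighbours of [g],
   against uniqueness. *)
have gS : g \in S.
  move: uH ugS; rewrite HE /cayley_adj => /set2P[]->.
    by rewrite mul1g SVE.
  by rewrite g2V.
have u1 : u = 1.
  by apply: u_uniq; split; [exact: group1 | rewrite /cayley_adj mul1g SVE].
have u2 : u = g ^+ 2.
  by apply: u_uniq; split; [rewrite HE set22 | rewrite /cayley_adj g2V].
by rewrite -u2 u1 eqxx in g2N1.
Qed.

Lemma perm_onS (T : finType) (A B : {set T}) (s : {perm T}) :
  A \subset B -> perm_on A s -> perm_on B s.
Proof. by move=> AB sA; apply: subset_trans sA AB. Qed.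

Lemma tperm_onS (T : finType) (A : {set T}) (y z : T) :
  y \in A -> z \in A -> perm_on A (tperm y z).
Proof.
by move=> yA zA; apply: perm_onS (tperm_on y z); rewrite subUset !sub1set yA.
Qed.

(** The root is a 4-cycle through the four points. Its support is recorded so that roots built on
    disjoint blocks commute. *)
Lemma tperm_mul_sqrt (T : finType) (a b c d : T) :
  uniq [:: a; b; c; d] ->
  exists2 s : {perm T}, perm_on [set a; b; c; d] s
                      & s ^+ 2 = tperm a b * tperm c d.
Proof.
rewrite /= !inE !negb_or -!andbA.
case/and4P=> ab ac ad /and4P[bc bd cd _].
(* [r] is an involution that conjugates [tperm a b] to [tperm c d], so the square of [tperm a b * r]
   is [tperm a b * tperm a b ^ r]. *)
pose r := tperm a c * tperm b d.
have rJ : tperm a b ^ r = tperm c d.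
  have dc : d != c by rewrite eq_sym.
  have cb : c != b by rewrite eq_sym.
  by rewrite tpermJ !permM tpermL (tpermD bc dc) (tpermD ab cb) tpermL.
have r2 : r * r = 1.
  have rC : commute (tperm a c) (tperm b d).
    apply: perm_onC (tperm_on a c) (tperm_on b d) _.
    rewrite disjoints_subset; apply/subsetP=> y.
    by rewrite !inE => /orP[]/eqP->; rewrite negb_or ?ab ?ad ?cd // eq_sym bc.
  by rewrite -expg2 expgMn // !expg2 !tperm2 mulg1.
have rV : r^-1 = r by rewrite -[LHS]mulg1 -r2 mulKg.
exists (tperm a b * r); last by rewrite expg2 -rJ conjgE rV !mulgA.
by rewrite !perm_onM ?tperm_onS // !inE eqxx ?orbT.
Qed.

Section ProdTperm.

Variables (n m : nat) (x : nat -> 'I_n).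
Hypothesis injx : {in [pred i | 0 < i <= m] &, injective x}.

(** Counting by the number [k] of transpositions allows induction one factor at a time; [A k] serves
    as a bound for the support of [t k]. *)
Let t k := prod_tperm k.*2 x.
Let A k := [set y | y \in [seq x i | i <- iota 1 k.*2]].

Let t0 : t 0 = 1.
Proof. by rewrite /t /prod_tperm big_geq. Qed.

Let tS k : t k.+1 = t k * tperm (x k.*2.+1) (x k.*2.+2).
Proof. by rewrite /t /prod_tperm !doubleK big_nat_recr. Qed.

Let mem_A k i : 0 < i <= k.*2 -> x i \in A k.
Proof.
by move=> i_k; rewrite inE; apply: map_f; rewrite mem_iota add1n ltnS.
Qed.

Let sub_A k l : k <= l -> A k \subset A l.
Proof.
move=> k_l; apply/subsetP=> y; rewrite inE => /mapP[i].
rewrite mem_iota add1n ltnS => /andP[i0 i_k] ->.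
by apply: mem_A; rewrite i0 (leq_trans i_k) // leq_double.
Qed.

Let notin_A k i : k.*2 < i <= m -> x i \notin A k.
Proof.
case/andP=> k_i i_m; rewrite inE; apply/mapP=> -[j].
rewrite mem_iota add1n ltnS => /andP[j0 j_k] /injx ij.
have j_i := leq_ltn_trans j_k k_i.
have := j_i; rewrite ij ?ltnn // inE ?j0 ?(leq_ltn_trans _ k_i) //=.
exact: leq_trans (ltnW j_i) i_m.
Qed.

Let tS_disjoint k : k.+1.*2 <= m ->
  [disjoint A k & [set x k.*2.+1; x k.*2.+2]].
Proof.
rewrite doubleS => k_m; rewrite disjoint_sym disjoints_subset.
apply/subsetP=> y; rewrite in_set2 in_setC => /orP[]/eqP->; apply: notin_A.
  by rewrite leqnn ltnW.
by rewrite leqnSn.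
Qed.

Let t_on k : perm_on (A k) (t k).
Proof.
elim: k => [|k IHk]; first by rewrite t0 perm_on1.
rewrite tS; apply: perm_onM; first exact: perm_onS (sub_A (leqnSn k)) IHk.
by apply: tperm_onS; apply: mem_A; rewrite doubleS ?leqnn ?leqnSn.
Qed.

Lemma prod_tperm_involutive k : k.*2 <= m -> prod_tperm k.*2 x ^+ 2 = 1.
Proof.
rewrite -/(t k); elim: k => [|k IHk] k_m; first by rewrite t0 expg1n.
rewrite tS expgMn; first by rewrite IHk ?mul1g ?expg2 ?tperm2 //
  (leq_trans _ k_m) // leq_double.
exact: perm_onC (t_on k) (tperm_on _ _) (tS_disjoint k_m).
Qed.

Lemma prod_tperm_neq1 k : 0 < k -> k.*2 <= m -> prod_tperm k.*2 x != 1.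
Proof.
case: k => // k _ k_m; rewrite -/(t k.+1); rewrite doubleS in k_m.
apply/eqP=> /permP/(_ (x k.*2.+1)).
(* The first [k] factors fix [x k.*2.+1], so only the last one acts on it, sending it to the
   distinct point [x k.*2.+2]. *)
rewrite tS permM (out_perm (t_on k)) ?notin_A ?ltnSn ?(ltnW k_m) //.
rewrite tpermL perm1 => /injx; rewrite !inE /= k_m (ltnW k_m) => /(_ isT isT)/eqP.
by rewrite eqn_leq ltnn.
Qed.

Lemma order_prod_tperm k : 0 < k -> k.*2 <= m -> #[prod_tperm k.*2 x] = 2.
Proof.
move=> k_gt0 k_m; apply: nt_prime_order => //.
  by rewrite prod_tperm_involutive.
exact (prod_tperm_neq1 k_gt0 k_m).
Qed.

Lemma odd_prod_tperm k : k.*2 <= m -> prod_tperm k.*2 x = odd k :> bool.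
Proof.
rewrite -/(t k); elim: k => [|k IHk] k_m; first by rewrite t0 odd_perm1.
rewrite tS odd_permM IHk; last by rewrite (leq_trans _ k_m) // leq_double.
rewrite odd_tperm /= (_ : _ != _) ?addbT //.
rewrite doubleS in k_m; apply/eqP=> /injx.
rewrite !inE /= k_m (ltnW k_m) => /(_ isT isT)/eqP.
by rewrite eqn_leq ltnn andbF.
Qed.

(** Consecutive transpositions are grouped in pairs; each pair has a root on its own four points,
    and the product of these commuting roots is a root of the whole. *)
Lemma prod_tperm_sqrt k :
  k.*2.*2 <= m -> exists s : 'S_n, s ^+ 2 = prod_tperm k.*2.*2 x.
Proof.
rewrite -/(t k.*2) => k_m.
(* The induction also has to carry the support of the root, which makes it commute with the root of
   the next pair. *)
suff [s _ s2] : exists2 s : 'S_n, perm_on (A k.*2) s & s ^+ 2 = t k.*2.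
  by exists s.
elim: k k_m => [|k IHk] k_m; first by exists 1; rewrite ?perm_on1 // expg1n t0.
have [|s s_on s2] := IHk; first by rewrite (leq_trans _ k_m) // !leq_double.
rewrite !doubleS in k_m *; set l := k.*2 in s_on s2 k_m *.
have [|c c_on c2]
  := @tperm_mul_sqrt _ (x l.*2.+1) (x l.*2.+2) (x l.*2.+3) (x l.*2.+4).
  (* Seen as the image under [x] of four consecutive indices, the points are distinct by
     injectivity. *)
  rewrite -[[:: _; _; _; _]]/[seq x i | i <- iota l.*2.+1 4].
  rewrite map_inj_in_uniq ?iota_uniq //.
  move=> i j; rewrite !mem_iota addn4 !ltnS => /andP[i0 i4] /andP[j0 j4].
  by apply: injx; rewrite inE ?(leq_ltn_trans _ i0, leq_ltn_trans _ j0) //=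
    (leq_trans _ k_m).
exists (s * c).
  apply: perm_onM; first exact: perm_onS (sub_A (leqW (leqnSn l))) s_on.
  apply: perm_onS c_on; rewrite !subUset !sub1set !mem_A ?doubleS //=;
    by repeat first [exact: leqnn | apply: leqW].
rewrite expgMn.
  by rewrite s2 c2 !tS doubleS mulgA.
apply: perm_onC s_on c_on _.
rewrite disjoint_sym disjoints_subset; apply/subsetP=> y; rewrite in_setC.
rewrite !in_setU !in_set1 -!orbA => /or4P[]/eqP->; apply: notin_A.
all: by apply/andP; split;
  [|apply: leq_trans k_m]; repeat first [exact: leqnn | apply: leqW].
Qed.

End ProdTperm.

Theorem theorem1 (n m : nat) (x : nat -> 'I_n) (H : {group 'S_n}) :
  2 <= n -> 2 <= m -> ~~ odd m ->
  (forall i j : nat, 1 <= i <= m -> 1 <= j <= m -> x i = x j -> i = j) ->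
  H :=: <[prod_tperm m x]>%g ->
  H \subset ('Alt_('I_n))%g ->
  ~ perfect_subgroup ('Sym_('I_n))%G H.
Proof.
move=> _ m_ge2 /even_halfK mE injx defH HAlt.
have: prod_tperm m x \in 'Alt_('I_n) by rewrite -cycle_subG -defH.
rewrite Alt_even => even_t.
set k := m./2 in mE; have k_m : k.*2 <= m by rewrite mE.
have k_gt0 : 0 < k by rewrite half_gt0.
have injx' : {in [pred i | 0 < i <= m] &, injective x} by move=> i j; apply: injx.
(* The sign of the generator is the parity of its number [k] of transpositions, so membership in the
   alternating group makes [m] a multiple of 4. *)
have /even_halfK kE : ~~ odd k.
  by rewrite -(odd_prod_tperm injx' k_m) mE.
have [g g2] : exists g : 'S_n, g ^+ 2 = prod_tperm m x.
  by rewrite -mE -kE; apply: (prod_tperm_sqrt injx'); rewrite kE mE.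
apply: (@cycle_square_not_perfect _ _ _ g); rewrite ?inE ?g2 //.
(* Since [g ^+ 2] has order 2, which is divisible by the prime 2, the order of [g] is 2 * 2 = 4. *)
apply: (@orderXprime _ 2 2) => //; rewrite g2 -mE.
by rewrite (order_prod_tperm injx').
Qed.
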